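(* Let $x^{*}:c_{\mathbb{R}_{\mathcal F}}\to\mathbb{R}$ be a map. Then $x^{*}$ is a linear continuous functional on $c_{\mathbb{R}_{\mathcal F}}$ (continuity with respect to the metric $\mu$) if and only if there exists a linear functional $L:S\overline{C}[0,1]\to\mathbb{R}$ such that $$x^{*}(x)=L(x_{-}+x_{+})\quad\text{for all } x=(x_n)_n\in c_{\mathbb{R}_{\mathcal F}},$$ and such that the restriction of $L$ to $SIC[0,1]$ is continuous on $SIC[0,1]$ with respect to the convergence induced by the metric on $S\overline{C}[0,1]$ defined by $$\Phi[(s_n)_n,(t_n)_n]=\sup\{\|s_n-t_n\|: n\in\mathbb{N}\},$$ where $\|\cdot\|$ is the uniform norm on $\overline{C}[0,1]$.
   Context: Fuzzy numbers: $\mathbb{R}_{\mathcal F}$ is the set of all functions $u:\mathbb{R}\to[0,1]$ such that (i) there is $x_u\in\mathbb{R}$ with $u(x_u)=1$; (ii) $u(tx+(1-t)y)\ge\min\{u(x),u(y)\}$ for all $t\in[0,1]$, $x,y\in\mathbb{R}$; (iii) $u$ is upper semicontinuous on $\mathbb{R}$; (iv) the closure of $\{x\in\mathbb{R}: u(x)>0\}$ is compact. Level sets: for $0<r\le 1$, $[u]^r=\{x\in\mathbb{R}:u(x)\ge r\}$, and $[u]^0=\overline{\{x\in\mathbb{R}:u(x)>0\}}$. Each $[u]^r$ is a compact interval, written $[u]^r=[u_-(r),u_+(r)]$; this defines functions $u_-,u_+:[0,1]\to\mathbb{R}$, which belong to the space $\overline{C}[0,1]$ below. Operations: $(u\oplus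 v)(x)=\sup_{y+z=x}\min\{u(y),v(z)\}$; for $\lambda\in\mathbb{R}$, $(\lambda\odot u)(x)=u(x/\lambda)$ if $\lambda\ne0$, and $0\odot u=\widetilde 0:=\chi_{\{0\}}$. Equivalently, $[u\oplus v]^r=[u]^r+[v]^r$ and $[\lambda\odot u]^r=\lambda[u]^r$ for all $r\in[0,1]$. Metric: $D(u,v)=\sup_{r\in[0,1]}\max\{|u_-(r)-v_-(r)|,|u_+(r)-v_+(r)|\}$. $c_{\mathbb{R}_{\mathcal F}}$ is the set of sequences $x=(x_n)_{n\in\mathbb{N}}$ in $\mathbb{R}_{\mathcal F}$ for which there is $a\in\mathbb{R}_{\mathcal F}$ with $D(x_n,a)\to0$, with termwise operations $\oplus,\odot$ and the metric $\mu(x,y)=\sup\{D(x_n,y_n):n\in\mathbb{N}\}$. A functional $A:c_{\mathbb{R}_{\mathcal F}}\to\mathbb{R}$ is called linear if $A(x\oplus y)=A(x)+A(y)$ and $A(\lambda\odot x)=\lambda A(x)$ for all $x,y\in c_{\mathbb{R}_{\mathcal F}}$ and all $\lambda\in\mathbb{R}$. Continuous means continuous at every point. $\overline{C}[0,1]$ is the real Banach space of all bounded functions $f:[0,1]\to\mathbb{R}$ that are left continuous at each point of $(0,1]$, have a right limit at each point of $[0,1)$, and are right continuous at $0$, with the uniform norm $\|f\|=\sup\{|f(x)|:x\in[0,1]\}$. $IC[0,1]=\{f\in\overline{C}[0,1]: f\text{ is increasing on }[0,1]\}$, where increasing means nondecreasing. $S\overline{C}[0,1]=\{(s_n)_n: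 s_n\in\overline{C}[0,1]\ \forall n\in\mathbb{N},\ (s_n)_n\text{ is uniformly convergent}\}$, a real vector space under termwise operations, and $SIC[0,1]=\{(s_n)_n: s_n\in IC[0,1]\ \forall n\in\mathbb{N},\ (s_n)_n\text{ is uniformly convergent}\}$ (uniform convergence on $[0,1]$ as $n\to\infty$). $L$ is linear in the usual vector space sense. For $x=(x_n)_n\in c_{\mathbb{R}_{\mathcal F}}$, $x_-=((x_n)_-)_n$ and $x_+=((x_n)_+)_n$; these are uniformly convergent sequences of functions, so they lie in $S\overline{C}[0,1]$. *)

(* Defs.v *)
From HB Require Import structures.
From mathcomp Require Import all_boot all_order all_algebra.
From mathcomp Require Import all_classical all_reals all_analysis.
From mathcomp Require Import ring lra.

Set Implicit Arguments.
Unset Strict Implicit.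
Unset Printing Implicit Defensive.

Import Order.TTheory GRing.Theory Num.Theory.
Import numFieldNormedType.Exports.

Local Open Scope classical_set_scope.
Local Open Scope ring_scope.

Notation unit_itv R := (set_type `[0 : Real.sort R, 1]).

Definition upper_semicontinuous (T : topologicalType) (R : realType)
    (u : T -> R) :=
  forall x a, u x < a -> \forall y \near x, u y < a.

Section fuzzy_numbers.
Context {R : realType}.
Implicit Types (u v : R -> R) (r s t x y z e : R).

Definition fuzzy u : Prop :=
  [/\ forall x, 0 <= u x <= 1,
      exists x, u x = 1,
      forall t x y, 0 <= t <= 1 ->
        Num.min (u x) (u y) <= u (t * x + (1 - t) * y),
      upper_semicontinuous u &
      compact (closure [set x | 0 < u x])].

(* The r-level set for 0 <= r <= 1; lower and upper are the two endpoints
   u_-(r) and u_+(r) of this compact interval, see levelE. *)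
Definition level u r : set R :=
  if r == 0 then closure [set x | 0 < u x] else [set x | r <= u x].

Definition lower u r : R := inf (level u r).
Definition upper u r : R := sup (level u r).

(* Endpoints of sums and of scalar multiples are computed in lower_foplus,
   upper_foplus and fscale_endpoints. *)
Definition foplus u v x : R :=
  sup [set Num.min (u yz.1) (v yz.2) | yz in [set yz : R * R | yz.1 + yz.2 = x]].

Definition fscale (l : R) u x : R :=
  if l == 0 then (x == 0)%:R else u (x / l).

Lemma fuzzy_bounded u : fuzzy u -> exists M, forall x, 0 < u x -> `|x| <= M.
Proof.
case=> _ _ _ _ /compact_bounded [M [_ hM]]; exists (M + 1) => x ux.
by apply: (hM (M + 1)); [lra | exact: subset_closure].
Qed.

Lemma bounded_compact_closure (A : set R) M :
  (forall x, A x -> `|x| <= M) -> compact (closure A).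
Proof.
move=> hA; apply: (@subclosed_compact _ _ `[- M, M]).
- exact: closed_closure.
- exact: segment_compact.
- rewrite (_ : [set` _] = closure `[- M, M]); last exact/closure_id/itv_closed.
  apply: closureS => x /hA; rewrite ler_norml /= in_itv /=.
  by move=> /andP[-> ->].
Qed.

Lemma level_closed u r : fuzzy u -> closed (level u r).
Proof.
case=> _ _ _ usc _; rewrite /level; case: eqP => _; first exact: closed_closure.
rewrite -[[set _ | _]]setCK; apply: open_closedC.
have -> : ~` [set x | r <= u x] = [set x | u x < r].
  by apply/seteqP; split => x /=; rewrite real_ltNge ?num_real// => /negP.
by rewrite openE => x /= /usc.
Qed.

Lemma level_anti u r s : fuzzy u -> 0 <= r -> r <= s -> level u s `<=` level u r.
Proof.
move=> _ r0; rewrite le_eqVlt => /predU1P[<-//|rs] x; rewrite /level.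
have s0 : 0 < s by lra.
rewrite (gt_eqF s0); case: eqP => _ /= sx; last by rewrite (le_trans _ sx) ?ltW.
by apply: subset_closure => /=; lra.
Qed.

Lemma level_neq0 u r : fuzzy u -> 0 <= r <= 1 -> level u r !=set0.
Proof.
move=> fu /andP[r0 r1]; have [_ [x ux] _ _ _] := fu; exists x.
by apply: (level_anti fu r0 r1); rewrite /level oner_eq0 /= ux.
Qed.

Lemma level_bounded u : fuzzy u -> exists M, forall r, 0 <= r -> forall x,
  level u r x -> `|x| <= M.
Proof.
move=> fu; have [_ _ _ _ /compact_bounded [M [_ hM]]] := fu; exists (M + 1).
move=> r r0 x /(level_anti fu (lexx 0) r0); rewrite /level eqxx.
by apply: hM; lra.
Qed.

Lemma level_convex u r x y z : fuzzy u -> 0 < r -> u x >= r -> u y >= r ->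
  x <= z <= y -> r <= u z.
Proof.
move=> [_ _ qc _ _] r0 rx ry /andP[xz zy].
have [exy|nxy] := eqVneq x y.
  by have -> : z = x by lra.
have xy : 0 < y - x by rewrite subr_gt0 lt_neqAle nxy (le_trans xz).
have h : 0 <= (y - z) / (y - x) <= 1.
  by rewrite divr_ge0 ?ler_pdivrMr/=; lra.
have := qc _ x y h; have -> : (y - z) / (y - x) * x + (1 - (y - z) / (y - x)) * y
   = z by field; rewrite gt_eqF.
by apply: le_trans; rewrite le_min rx ry.
Qed.

Lemma level_endpoints u r : fuzzy u -> 0 <= r <= 1 ->
  level u r (lower u r) /\ level u r (upper u r).
Proof.
move=> fu r01; have r0 : 0 <= r by case/andP: r01.
have [M hM] := level_bounded fu; have ne := level_neq0 fu r01.
have ub : has_ubound (level u r).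
  by exists M => x /(hM _ r0); rewrite ler_norml => /andP[].
have lb : has_lbound (level u r).
  by exists (- M) => x /(hM _ r0); rewrite ler_norml => /andP[].
split; rewrite (iffLR (closure_id _) (level_closed (r := r) fu)); last first.
  exact: closure_sup.
rewrite /lower => B /nbhs_ballP[e /= e0 eB].
have [y ry yl] := inf_adherent e0 (conj ne lb).
exists y; split => //; apply: eB; rewrite /ball /= ltr_distlC.
by have := ge_inf lb ry; lra.
Qed.

Lemma lower_le_upper u r : fuzzy u -> 0 <= r <= 1 -> lower u r <= upper u r.
Proof.
move=> fu r01; have [hl hu] := level_endpoints fu r01.
have [M hM] := level_bounded fu; case/andP: r01 => r0 _.
apply: ge_inf => //; exists (- M) => x /(hM _ r0).
by rewrite ler_norml => /andP[].
Qed.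

Lemma levelE u r : fuzzy u -> 0 <= r <= 1 ->
  level u r = `[lower u r, upper u r]%classic.
Proof.
move=> fu r01; have [hl hu] := level_endpoints fu r01.
have [M hM] := level_bounded fu; have r0 : 0 <= r by case/andP: r01.
apply/seteqP; split => x /=; rewrite in_itv /=.
  move=> rx; rewrite ge_inf ?ub_le_sup //.
    by exists M => y /(hM _ r0); rewrite ler_norml => /andP[].
  by exists (- M) => y /(hM _ r0); rewrite ler_norml => /andP[].
move=> /andP[lx xu]; have [r00|rn0] := eqVneq r 0; last first.
  move: hl hu; rewrite /level (negPf rn0) /= => hl hu.
  by apply: (level_convex fu _ hl hu); [rewrite lt_neqAle eq_sym rn0|lra].
move: hl hu; rewrite /level r00 eqxx => hl hu.
have [ux|ux] := ltP 0 (u x); first exact: subset_closure.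
have [xl|xl] := eqVneq x (lower u 0); first by rewrite xl.
have [xu'|xu'] := eqVneq x (upper u 0); first by rewrite xu'.
rewrite r00 in lx xu.
have d1 : 0 < x - lower u 0 by rewrite subr_gt0 lt_neqAle eq_sym xl.
have d2 : 0 < upper u 0 - x by rewrite subr_gt0 lt_neqAle xu'.
have [p [/= p0]] := hl _ (nbhsx_ballx _ _ d1).
rewrite /ball /= ltr_distlC => p1.
have [q [/= q0]] := hu _ (nbhsx_ballx _ _ d2).
rewrite /ball /= ltr_distlC => q1.
have m0 : 0 < Num.min (u p) (u q) by rewrite lt_min p0.
suff : Num.min (u p) (u q) <= u x by lra.
by apply: (level_convex fu m0 (x := p) (y := q)); rewrite ?ge_min ?lexx ?orbT//; lra.
Qed.

Lemma levelP u r x : fuzzy u -> 0 < r <= 1 ->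
  (r <= u x) = (lower u r <= x <= upper u r).
Proof.
move=> fu /andP[r0 r1]; have := levelE (r := r) fu; rewrite /level gt_eqF//.
rewrite (ltW r0) r1 => /(_ isT) /(congr1 (fun A => A x)) /= h.
by apply/idP/idP; rewrite h in_itv.
Qed.

Lemma lower_mono u r s : fuzzy u -> 0 <= r -> r <= s -> s <= 1 ->
  lower u r <= lower u s.
Proof.
move=> fu r0 rs s1; have [] := level_endpoints (r := s) fu; first by lra.
move=> /(level_anti fu r0 rs) + _; rewrite levelE//; last lra.
by rewrite /= in_itv /= => /andP[].
Qed.

Lemma fuzzy_eq u v : fuzzy u -> fuzzy v ->
  (forall r, 0 <= r <= 1 -> lower u r = lower v r) ->
  (forall r, 0 <= r <= 1 -> upper u r = upper v r) -> u = v.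
Proof.
move=> fu fv hl hu; apply/funext => x.
have [/(_ x)u01 _ _ _ _] := fu; have [/(_ x)v01 _ _ _ _] := fv.
apply/eqP; rewrite eq_le; apply/andP; split.
  have [u0|u0] := leP (u x) 0; first by lra.
  by rewrite levelP// -?hl -?hu -?levelP//; lra.
have [v0|v0] := leP (v x) 0; first by lra.
by rewrite levelP// ?hl ?hu -?levelP//; lra.
Qed.

Lemma lower_left u r e : fuzzy u -> 0 < r <= 1 -> 0 < e ->
  exists d, 0 < d /\ forall s, 0 <= s -> r - d < s -> s <= r ->
    lower u r - e < lower u s <= lower u r.
Proof.
move=> fu r01 e0; pose p := lower u r - e.
have /negbT : (r <= u p) = false.
  by rewrite levelP//; apply/negP; rewrite /p; lra.
rewrite -ltNge => upr; have [/(_ p) u01 _ _ _ _] := fu.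
exists (r - u p); split; first lra.
move=> s s0 ds sr; rewrite lower_mono ?andbT//; last lra.
have s1 : 0 < s <= 1 by lra.
have /negbT : (s <= u p) = false by apply/negP; lra.
rewrite levelP// negb_and => /orP[]; first by rewrite -ltNge.
rewrite -ltNge => h; have := lower_le_upper (r := r) fu.
have := levelP (lower u r) fu r01; rewrite lexx lower_le_upper//; last lra.
move=> h1 _; have : s <= u (lower u r) by lra.
by rewrite levelP// => /andP[_]; rewrite /p in h *; lra.
Qed.

Lemma lower_right0 u e : fuzzy u -> 0 < e ->
  exists d, 0 < d /\ forall s, 0 <= s -> s < d -> s <= 1 ->
    lower u 0 <= lower u s < lower u 0 + e.
Proof.
move=> fu e0; have [] := level_endpoints (r := 0) fu; first by rewrite lexx ler01.
rewrite {1}/level eqxx => h _; have [p [/= p0]] := h _ (nbhsx_ballx _ _ e0).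
rewrite /ball /= ltr_distlC => p1; have [/(_ p) u01 _ _ _ _] := fu.
exists (u p); split => // s s0 sp s1; rewrite lower_mono//=.
have := lower_mono fu s0 (ltW sp) (proj2 (andP u01)).
have := levelP (r := u p) p fu; rewrite lexx p0 => /(_ (proj2 (andP u01))).
by move=> /esym/andP[]; lra.
Qed.

Lemma nbhs_all (x : R) (P : R -> Prop) : (forall y, P y) -> \forall y \near x, P y.
Proof. by move=> h; near do exact: h.
Unshelve. all: by end_near. Qed.

Lemma fuzzy_chi0 : fuzzy (fun x : R => (x == 0)%:R).
Proof.
split.
- by move=> x; case: eqP => _; rewrite ?lexx ?ler01.
- by exists 0; rewrite eqxx.
- move=> t x y _; have [->|x0] := eqVneq x 0; last first.
    by rewrite ge_min ler0n.
  have [->|y0] := eqVneq y 0; last by rewrite ge_min ler0n orbT.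
  by rewrite !mulr0 addr0 eqxx minxx.
- move=> x a; have [->|x0] := eqVneq x 0 => xa.
    by apply: nbhs_all => y; apply: le_lt_trans xa; case: eqP.
  have x1 : 0 < `|x| by rewrite normr_gt0.
  apply: filterS (nbhsx_ballx x _ x1) => y; rewrite /ball /=.
  by case: (eqVneq y 0) => [->|//]; rewrite subr0 ltxx.
- apply: (@bounded_compact_closure _ 0) => x /=.
  by case: eqP => [->|_]; rewrite ?ltxx// normr0.
Qed.

Lemma fscale_convE t x y l : l != 0 ->
  (t * x + (1 - t) * y) / l = t * (x / l) + (1 - t) * (y / l).
Proof. by move=> l0; field. Qed.

Lemma fuzzy_fscale l u : fuzzy u -> fuzzy (fscale l u).
Proof.
move=> fu; have [u01 [x0 ux0] qc usc _] := fu; have [l0|l0] := eqVneq l 0.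
  suff -> : fscale l u = fun x : R => (x == 0)%:R by exact: fuzzy_chi0.
  by rewrite /fscale l0 eqxx.
have -> : fscale l u = fun x => u (x / l).
  by apply/funext => x; rewrite /fscale (negPf l0).
split => //.
- by exists (x0 * l); rewrite mulfK.
- by move=> t x y t01; rewrite fscale_convE//; exact: qc.
- move=> x a /usc; have : (fun y => y / l) @ x --> x / l.
    by apply: cvgMl; exact: cvg_id.
  by move=> h /h.
- have [M hM] := fuzzy_bounded fu.
  apply: (@bounded_compact_closure _ (M * `|l|)) => x /= /hM.
  by rewrite normrM normfV ler_pdivrMr ?normr_gt0.
Qed.

Lemma level_fscale l u r : l != 0 ->
  level (fscale l u) r = [set x | level u r (x / l)].
Proof.
move=> l0; have fE : fscale l u = fun x => u (x / l).
  by apply/funext => x; rewrite /fscale (negPf l0).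
have hc (k : R) x : (fun y => y * k) @ x --> x * k.
  by apply: cvgMl; exact: cvg_id.
rewrite fE /level; case: eqP => // _. apply/seteqP; split => x /= hx B.
  move=> /(hc l^-1) /hx [y [/= uy By]]; exists (y / l); split => //.
rewrite -{1}(divfK l0 x) => /hc /hx [y [/= uy By]]; exists (y * l); split => //=.
by rewrite mulfK.
Qed.

Lemma fscale_endpoints l u r : fuzzy u -> 0 <= r <= 1 ->
  lower (fscale l u) r = (if 0 <= l then l * lower u r else l * upper u r) /\
  upper (fscale l u) r = (if 0 <= l then l * upper u r else l * lower u r).
Proof.
move=> fu r01; have lu := lower_le_upper fu r01.
have fs := fuzzy_fscale l fu.
suff : level (fscale l u) r = if 0 <= l then
    `[l * lower u r, l * upper u r]%classic
  else `[l * upper u r, l * lower u r]%classic.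
  rewrite /lower /upper => ->; case: ifPn => l0.
    by rewrite inf_itvcc ?sup_itvcc// ler_wpM2l.
  by rewrite inf_itvcc ?sup_itvcc// ler_wnM2l//; rewrite -ltNge in l0; exact: ltW.
have [->|l0] := eqVneq l 0.
  rewrite lexx !mul0r set_itv1 /level /fscale eqxx.
  case: ifPn => [_|rn0].
    have -> : [set x : R | 0 < ((x == 0)%:R : R)] = [set 0].
      by apply/seteqP; split => x /=; rewrite ltr0n lt0b => /eqP.
    by apply/esym/closure_id; exact: closed_eq.
  apply/seteqP; split => x /=; last by move->; rewrite eqxx; case/andP: r01.
  case: eqP => //= _ r0; exfalso; move/negP: rn0; apply; rewrite eq_le r0.
  by case/andP: r01.
rewrite level_fscale// levelE//; apply/seteqP; split => x /=.
  case: ifPn => [lp|ln]; rewrite /= !in_itv /=.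
    have lp' : 0 < l by rewrite lt_neqAle eq_sym l0.
    by rewrite ler_pdivlMr// ler_pdivrMr// !(mulrC l).
  rewrite -ltNge in ln; rewrite ler_ndivlMr// ler_ndivrMr// !(mulrC l).
  by move=> /andP[-> ->].
case: ifPn => [lp|ln]; rewrite /= !in_itv /=.
  have lp' : 0 < l by rewrite lt_neqAle eq_sym l0.
  by rewrite ler_pdivlMr// ler_pdivrMr// !(mulrC l).
rewrite -ltNge in ln; rewrite ler_ndivlMr// ler_ndivrMr// !(mulrC l).
by move=> /andP[-> ->].
Qed.

Lemma upperN u r : fuzzy u -> 0 <= r <= 1 ->
  upper u r = - lower (fscale (-1) u) r.
Proof.
move=> fu r01; have [-> _] := fscale_endpoints (-1) fu r01.
by rewrite oppr_ge0 (lt_geF ltr01) mulN1r opprK.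
Qed.

Lemma upper_mono u r s : fuzzy u -> 0 <= r -> r <= s -> s <= 1 ->
  upper u s <= upper u r.
Proof.
move=> fu r0 rs s1; have ? : 0 <= s <= 1 by lra.
have ? : 0 <= r <= 1 by lra.
rewrite !upperN// lerN2.
by apply: lower_mono => //; exact: fuzzy_fscale.
Qed.

Lemma upper_left u r e : fuzzy u -> 0 < r <= 1 -> 0 < e ->
  exists d, 0 < d /\ forall s, 0 <= s -> r - d < s -> s <= r ->
    upper u r <= upper u s < upper u r + e.
Proof.
move=> fu r01 e0.
have [d [d0 hd]] := lower_left (fuzzy_fscale (-1) fu) r01 e0.
exists d; split => // s s0 ds sr; have := hd s s0 ds sr.
by rewrite !upperN//; lra.
Qed.

Lemma upper_right0 u e : fuzzy u -> 0 < e ->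
  exists d, 0 < d /\ forall s, 0 <= s -> s < d -> s <= 1 ->
    upper u 0 - e < upper u s <= upper u 0.
Proof.
move=> fu e0.
have [d [d0 hd]] := lower_right0 (fuzzy_fscale (-1) fu) e0.
exists d; split => // s s0 ds s1; have := hd s s0 ds s1.
by rewrite !upperN//; lra.
Qed.

Lemma foplus01 u v x : fuzzy u -> fuzzy v -> 0 <= foplus u v x <= 1.
Proof.
move=> [u01 _ _ _ _] [v01 _ _ _ _]; rewrite /foplus; set S := [set _ | _ in _].
have S0 : S (Num.min (u x) (v 0)) by exists (x, 0) => //=; rewrite addr0.
have ubS : ubound S 1.
  by move=> _ [[y z] _ <-] /=; rewrite ge_min; case/andP: (u01 y) => _ ->.
rewrite ge_sup ?andbT//; last by exists (Num.min (u x) (v 0)).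
apply: le_trans (ub_le_sup _ S0); last by exists 1.
by rewrite le_min; case/andP: (u01 x) => -> _; case/andP: (v01 0) => -> _.
Qed.

Lemma foplusP u v r x : fuzzy u -> fuzzy v -> 0 < r <= 1 ->
  (r <= foplus u v x) =
  (lower u r + lower v r <= x <= upper u r + upper v r).
Proof.
move=> fu fv r01; have [u01 _ _ _ _] := fu.
have r01' : 0 <= r <= 1 by lra.
rewrite /foplus; set S := [set _ | _ in _].
have S0 : S !=set0 by exists (Num.min (u x) (v 0)), (x, 0) => //=; rewrite addr0.
have ubS : has_ubound S.
  by exists 1 => _ [[y z] _ <-] /=; rewrite ge_min; case/andP: (u01 y) => _ ->.
have lu := lower_le_upper fu r01'; have lv := lower_le_upper fv r01'.
apply/idP/idP => [rS|xr].
  have key s : 0 < s -> s < r ->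
      lower u s + lower v s <= x <= upper u s + upper v s.
    move=> s0 sr; have rs : 0 < r - s by lra.
    have [_ [[y z] /= yz <-]] := sup_adherent rs (conj S0 ubS).
    rewrite -/S => /ltW.
    have hs : s <= sup S - (r - s).
      by move: rS; move: (sup S) => m rm; clear -rm; lra.
    move=> /(le_trans hs).
    have s1 : 0 < s <= 1 by lra.
    rewrite le_min (levelP _ fu s1) (levelP _ fv s1) => /andP[hy hz]; clear S0 ubS.
    by subst x; lra.
  have mid d1 d2 : 0 < d1 -> 0 < d2 ->
      exists s, [/\ 0 < s, s < r, r - d1 < s & r - d2 < s].
    move=> d10 d20; pose s := Num.max (r / 2) (Num.max (r - d1 / 2) (r - d2 / 2)).
    have : s < r by rewrite /s !gt_max; apply/and3P; split; lra.
    have : s <= s by [].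
    by rewrite {1}/s !ge_max => /and3P[? ? ?] ?; exists s; split => //; lra.
  apply/andP; split; apply/ler_addgt0Pr => e e0.
    have e20 : 0 < e / 2 by lra.
    have [d1 [d10 h1]] := lower_left fu r01 e20.
    have [d2 [d20 h2]] := lower_left fv r01 e20.
    have [s [s0 sr s1 s2]] := mid _ _ d10 d20.
    have := key _ s0 sr; have := h1 s (ltW s0) s1 (ltW sr).
    by have := h2 s (ltW s0) s2 (ltW sr); lra.
  have e20 : 0 < e / 2 by lra.
  have [d1 [d10 h1]] := upper_left fu r01 e20.
  have [d2 [d20 h2]] := upper_left fv r01 e20.
  have [s [s0 sr s1 s2]] := mid _ _ d10 d20.
  have := key _ s0 sr; have := h1 s (ltW s0) s1 (ltW sr).
  by have := h2 s (ltW s0) s2 (ltW sr); lra.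
pose y := Num.max (lower u r) (x - upper v r).
apply: (@le_trans _ _ (Num.min (u y) (v (x - y)))).
  rewrite le_min (levelP _ fu r01) (levelP _ fv r01); rewrite /y.
  clear S S0 ubS y.
  by case: (leP (lower u r) (x - upper v r)) => ?; lra.
by apply: ub_le_sup => //; exists (y, x - y) => //=; rewrite addrC subrK.
Qed.

Lemma fuzzy_foplus u v : fuzzy u -> fuzzy v -> fuzzy (foplus u v).
Proof.
move=> fu fv; have w01 x := foplus01 x fu fv.
split => //.
- exists (lower u 1 + lower v 1).
  have : 1 <= foplus u v (lower u 1 + lower v 1).
    have h1 : 0 <= (1 : R) <= 1 by rewrite ler01 lexx.
    have h2 : 0 < (1 : R) <= 1 by rewrite ltr01 lexx.
    rewrite (foplusP _ fu fv h2).
    by have := lower_le_upper fu h1; have := lower_le_upper fv h1; lra.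
  by have := w01 (lower u 1 + lower v 1); lra.
- move=> t x y t01; set m := Num.min _ _.
  have [m0|m0] := leP m 0.
    by have := w01 (t * x + (1 - t) * y); lra.
  have m1 : 0 < m <= 1.
    by rewrite m0 /m ge_min; case/andP: (w01 x) => _ ->.
  have : m <= m by []; rewrite {2}/m le_min (foplusP x fu fv m1) (foplusP y fu fv m1) (foplusP _ fu fv m1) => /andP[hx hy].
  have t0 : 0 <= t by lra.
  have t1 : 0 <= 1 - t by lra.
  move: hx hy => /andP[hx1 hx2] /andP[hy1 hy2].
  have := ler_wpM2l t0 hx1; have := ler_wpM2l t0 hx2.
  have := ler_wpM2l t1 hy1; have := ler_wpM2l t1 hy2.
  by lra.
- move=> x a wa; have [a1|a1] := ltP 1 a.
    by apply: nbhs_all => y; have := w01 y; lra.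
  have a0 : 0 < a by have := w01 x; lra.
  have a01 : 0 < a <= 1 by lra.
  have /negbT := lt_geF wa; rewrite (foplusP _ fu fv a01) negb_and -!ltNge => /orP[] h.
    have d0 : 0 < lower u a + lower v a - x by lra.
    apply: filterS (nbhsx_ballx x _ d0) => y; rewrite /ball /= ltr_distlC => hy.
    by rewrite ltNge (foplusP _ fu fv a01); lra.
  have d0 : 0 < x - (upper u a + upper v a) by lra.
  apply: filterS (nbhsx_ballx x _ d0) => y; rewrite /ball /= ltr_distlC => hy.
  by rewrite ltNge (foplusP _ fu fv a01); lra.
- pose M := `|lower u 0 + lower v 0| + `|upper u 0 + upper v 0|.
  apply: (@bounded_compact_closure _ M) => x /= w0.
  have h1 : 0 < foplus u v x <= 1 by have := w01 x; lra.
  have := lexx (foplus u v x); rewrite (foplusP _ fu fv h1).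
  have h0 : 0 <= foplus u v x by lra.
  have h2 : foplus u v x <= 1 by lra.
  have := lower_mono fu (lexx 0) h0 h2; have := lower_mono fv (lexx 0) h0 h2.
  have := upper_mono fu (lexx 0) h0 h2; have := upper_mono fv (lexx 0) h0 h2.
  have := ler_norm (upper u 0 + upper v 0).
  have := lerNnormlW (lexx `|lower u 0 + lower v 0|).
  have := normr_ge0 (upper u 0 + upper v 0).
  have := normr_ge0 (lower u 0 + lower v 0).
  by rewrite /M ler_norml; lra.
Qed.

Lemma foplus_endpoints_gt0 u v r : fuzzy u -> fuzzy v -> 0 < r <= 1 ->
  lower (foplus u v) r = lower u r + lower v r /\
  upper (foplus u v) r = upper u r + upper v r.
Proof.
move=> fu fv r01; have r01' : 0 <= r <= 1 by lra.
have lu := lower_le_upper fu r01'; have lv := lower_le_upper fv r01'.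
have : level (foplus u v) r =
    `[lower u r + lower v r, upper u r + upper v r]%classic.
  have r0 : 0 < r by lra.
  rewrite /level (gt_eqF r0).
  by apply/seteqP; split => x /=; rewrite in_itv /= foplusP.
have hle := lerD lu lv.
by rewrite [lower (foplus _ _) _]/lower [upper (foplus _ _) _]/upper => ->; rewrite inf_itvcc ?sup_itvcc.
Qed.

Lemma lower_foplus u v r : fuzzy u -> fuzzy v -> 0 <= r <= 1 ->
  lower (foplus u v) r = lower u r + lower v r.
Proof.
move=> fu fv /andP[]; rewrite le_eqVlt => /predU1P[<- _|r0 r1]; last first.
  by apply: (proj1 (foplus_endpoints_gt0 _ _ _)) => //; rewrite r0.
have key e : 0 < e -> `|lower (foplus u v) 0 - (lower u 0 + lower v 0)| <= e.
  move=> e0; have e20 : 0 < e / 2 by lra.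
  have [d1 [d10 h1]] := lower_right0 fu e20.
  have [d2 [d20 h2]] := lower_right0 fv e20.
  have [d3 [d30 h3]] := lower_right0 (fuzzy_foplus fu fv) e20.
  pose m := Num.min (Num.min d1 d2) (Num.min d3 1).
  have m0 : 0 < m by rewrite !lt_min d10 d20 d30 ltr01.
  have : m <= m by []; rewrite {2}/m !le_min => /andP[/andP[? ?] /andP[? ?]].
  pose s := m / 2; have s01 : 0 < s <= 1 by rewrite /s; lra.
  have [] := foplus_endpoints_gt0 fu fv s01; have := h1 s; have := h2 s.
  have := h3 s; have s0 : 0 <= s by lra.
  have s1 : s <= 1 by lra.
  have ? : s < d1 by rewrite /s; lra.
  have ? : s < d2 by rewrite /s; lra.
  have ? : s < d3 by rewrite /s; lra.
  move=> /(_ s0) + /(_ s0) + /(_ s0) => /(_ _ s1) + /(_ _ s1) + /(_ _ s1).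
  by do 3 (move=> /(_ ltac:(assumption)) /andP[? ?]); move=> ? _;
     rewrite ler_norml; apply/andP; split; lra.
apply/eqP; rewrite -subr_eq0 -normr_le0; apply/ler_addgt0Pr => e e0.
by rewrite add0r; exact: key.
Qed.

Lemma fscaleN_foplus u v : fuzzy u -> fuzzy v ->
  fscale (-1) (foplus u v) = foplus (fscale (-1) u) (fscale (-1) v).
Proof.
move=> fu fv; apply/funext => x.
rewrite /fscale oppr_eq0 (negPf (oner_neq0 _)) /foplus; congr sup.
apply/seteqP; split => _ [[y z] /= yz <-]; exists (- y, - z) => //=.
- by move: yz; rewrite invrN1 mulrN1; lra.
- by rewrite invrN1 !mulrN1 !opprK.
- by move: yz; rewrite invrN1 mulrN1; lra.
- by rewrite invrN1 !mulrN1.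
Qed.

Lemma upper_foplus u v r : fuzzy u -> fuzzy v -> 0 <= r <= 1 ->
  upper (foplus u v) r = upper u r + upper v r.
Proof.
move=> fu fv r01; have fw := fuzzy_foplus fu fv.
rewrite !upperN// fscaleN_foplus// lower_foplus ?opprD//; exact: fuzzy_fscale.
Qed.

End fuzzy_numbers.

Section fuzzy_metric.
Context {R : realType}.

Record fuzzyNumber := FuzzyNumber {
  membership :> R -> R ;
  fuzzyP : fuzzy membership }.

Implicit Types u v w : fuzzyNumber.

Definition fadd u v := FuzzyNumber (fuzzy_foplus (fuzzyP u) (fuzzyP v)).
Definition fmul (l : R) u := FuzzyNumber (fuzzy_fscale l (fuzzyP u)).

(* The real-valued sup is only meaningful on nonempty bounded sets: this is
   checked in fdist_has_sup, cdist_has_sup, unorm_has_sup and Phi_has_sup for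
   the four suprema used below. *)
Definition fdist u v : R :=
  sup [set Num.max `|lower u r - lower v r| `|upper u r - upper v r|
      | r in `[0, 1]].

Lemma fuzzyNumber_eq u v : (u : R -> R) = v -> u = v.
Proof. by case: u v => u pu [v pv] /= uv; subst v; congr FuzzyNumber. Qed.

Lemma fdist_has_sup u v :
  has_sup [set Num.max `|lower u r - lower v r| `|upper u r - upper v r|
          | r in `[0, 1]].
Proof.
split; first by eexists; exists 0 => //=; rewrite in_itv /= lexx ler01.
have [M hM] := level_bounded (fuzzyP u); have [N hN] := level_bounded (fuzzyP v).
exists (M + N) => _ [r /= + <-]; rewrite in_itv /= => r01.
have r0 : 0 <= r by case/andP: r01.
have [lu uu] := level_endpoints (fuzzyP u) r01.
have [lv uv] := level_endpoints (fuzzyP v) r01.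
by rewrite ge_max; apply/andP; split; apply: le_trans (ler_normB _ _) _;
  apply: lerD; first [exact: hM lu|exact: hN lv|exact: hM uu|exact: hN uv].
Qed.

Lemma fdist_leP u v d : fdist u v <= d <->
  forall r, 0 <= r <= 1 ->
    `|lower u r - lower v r| <= d /\ `|upper u r - upper v r| <= d.
Proof.
have [S0 Sb] := fdist_has_sup u v; split => [D r r01|h].
  suff : Num.max `|lower u r - lower v r| `|upper u r - upper v r| <= d.
    by rewrite ge_max => /andP.
  by apply: le_trans D; apply: ub_le_sup => //; exists r => //=; rewrite in_itv.
apply: ge_sup => // _ [r /= + <-]; rewrite in_itv /= => /h[].
by rewrite ge_max => -> ->.
Qed.

Lemma fdist_le u v r : 0 <= r <= 1 ->
  `|lower u r - lower v r| <= fdist u v /\ `|upper u r - upper v r| <= fdist u v.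
Proof. exact: (iffLR (fdist_leP u v _) (lexx _)). Qed.

Lemma fdist_ge0 u v : 0 <= fdist u v.
Proof.
have /(fdist_le u v)[h _] : 0 <= (0 : R) <= 1 by rewrite lexx ler01.
exact: le_trans (normr_ge0 _) h.
Qed.

Lemma fdistxx u : fdist u u = 0.
Proof.
apply/eqP; rewrite eq_le fdist_ge0 andbT; apply/fdist_leP => r _.
by rewrite !subrr normr0.
Qed.

Lemma fdist_eq0 u v : fdist u v = 0 -> u = v.
Proof.
move=> D0; apply: fuzzyNumber_eq; apply: fuzzy_eq; try exact: fuzzyP.
  by move=> r /(fdist_le u v)[]; rewrite D0 normr_le0 subr_eq0 => /eqP.
by move=> r /(fdist_le u v)[_]; rewrite D0 normr_le0 subr_eq0 => /eqP.
Qed.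

Lemma fdistC u v : fdist u v = fdist v u.
Proof.
suff h x y : fdist x y <= fdist y x by apply/eqP; rewrite eq_le !h.
by apply/fdist_leP => r /(fdist_le y x)[h1 h2]; split; rewrite distrC.
Qed.

Lemma fdist_triangle v u w : fdist u w <= fdist u v + fdist v w.
Proof.
apply/fdist_leP => r r01; have [h1 h2] := fdist_le u v r01.
have [h3 h4] := fdist_le v w r01.
by split; [apply: le_trans (ler_distD (lower v r) _ _) _
  | apply: le_trans (ler_distD (upper v r) _ _) _]; apply: lerD.
Qed.

Lemma fdist_fadd u u' v v' :
  fdist (fadd u v) (fadd u' v') <= fdist u u' + fdist v v'.
Proof.
apply/fdist_leP => r r01; have [h1 h2] := fdist_le u u' r01.
have [h3 h4] := fdist_le v v' r01.
rewrite /= !lower_foplus ?upper_foplus//; try exact: fuzzyP.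
rewrite !opprD (addrACA (lower _ _)) (addrACA (upper _ _)); split.
  by apply: le_trans (ler_normD _ _) _; apply: lerD.
by apply: le_trans (ler_normD _ _) _; apply: lerD.
Qed.

Lemma fdist_fmul l u v : fdist (fmul l u) (fmul l v) <= `|l| * fdist u v.
Proof.
apply/fdist_leP => r r01; have [h1 h2] := fdist_le u v r01.
have [-> ->] := fscale_endpoints l (fuzzyP u) r01.
have [-> ->] := fscale_endpoints l (fuzzyP v) r01.
by case: ifP => _; rewrite -!mulrBr !normrM !ler_wpM2l.
Qed.

End fuzzy_metric.
Arguments fuzzyNumber R : clear implicits.

Section fuzzy_sequences.
Context {R : realType}.

Definition fuzzy_cvg (x : nat -> fuzzyNumber R) (a : fuzzyNumber R) :=
  fdist (x n) a @[n --> \oo] --> 0.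

Record fuzzyc := Fuzzyc {
  fuzzyc_seq :> nat -> fuzzyNumber R ;
  fuzzyc_cvg : exists a, fuzzy_cvg fuzzyc_seq a }.

Implicit Types x y z : fuzzyc.

Lemma fuzzyc_eq x y : (x : nat -> _) = y -> x = y.
Proof. by case: x y => x px [y py] /= xy; subst y; congr Fuzzyc. Qed.

HB.instance Definition _ := gen_eqMixin fuzzyc.
HB.instance Definition _ := gen_choiceMixin fuzzyc.

Lemma cadd_subproof x y : exists a, fuzzy_cvg (fun n => fadd (x n) (y n)) a.
Proof.
have [a xa] := fuzzyc_cvg x; have [b yb] := fuzzyc_cvg y; exists (fadd a b).
apply: (@squeeze_cvgr _ _ _ _ (fun=> 0) (fun n => fdist (x n) a + fdist (y n) b)).
- by near=> n; rewrite fdist_ge0 fdist_fadd.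
- exact: cvg_cst.
- by rewrite -[0]addr0; apply: cvgD.
Unshelve. all: by end_near. Qed.

Lemma cmul_subproof (l : R) x : exists a, fuzzy_cvg (fun n => fmul l (x n)) a.
Proof.
have [a xa] := fuzzyc_cvg x; exists (fmul l a).
apply: (@squeeze_cvgr _ _ _ _ (fun=> 0) (fun n => `|l| * fdist (x n) a)).
- by near=> n; rewrite fdist_ge0 fdist_fmul.
- exact: cvg_cst.
- by rewrite -[0](mulr0 `|l|); apply: cvgMr.
Unshelve. all: by end_near. Qed.

Definition cadd x y := Fuzzyc (cadd_subproof x y).
Definition cmul l x := Fuzzyc (cmul_subproof l x).

Definition cdist x y : R := sup (range (fun n => fdist (x n) (y n))).

Lemma cdist_has_sup x y : has_sup (range (fun n => fdist (x n) (y n))).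
Proof.
split; first by eexists; exists 0%N.
have [a xa] := fuzzyc_cvg x; have [b yb] := fuzzyc_cvg y.
have /cvg_seq_bounded/bounded_fun_has_ubound[M hM] := cvgP _ xa.
have /cvg_seq_bounded/bounded_fun_has_ubound[N hN] := cvgP _ yb.
exists (M + (fdist a b + N)) => _ [n _ <-].
apply: le_trans (fdist_triangle a _ _) _; apply: lerD.
  by apply: hM; exists n.
apply: le_trans (fdist_triangle b _ _) _; apply: lerD => //.
by rewrite fdistC; apply: hN; exists n.
Qed.

Lemma cdist_leP x y d : cdist x y <= d <-> forall n, fdist (x n) (y n) <= d.
Proof.
have [S0 Sb] := cdist_has_sup x y; split => [D n|h].
  by apply: le_trans D; apply: ub_le_sup => //; exists n.
by apply: ge_sup => // _ [n _ <-].
Qed.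

Lemma cdist_le x y n : fdist (x n) (y n) <= cdist x y.
Proof. exact: (iffLR (cdist_leP x y _) (lexx _)). Qed.

Lemma cdistxx x : cdist x x = 0.
Proof.
apply/eqP; rewrite eq_le (le_trans (fdist_ge0 _ _) (cdist_le x x 0)) andbT.
by apply/cdist_leP => n; rewrite fdistxx.
Qed.

Lemma cdist_eq0 x y : cdist x y = 0 -> x = y.
Proof.
move=> D0; apply: fuzzyc_eq; apply/funext => n; apply: fdist_eq0.
by apply/eqP; rewrite eq_le fdist_ge0 andbT -D0 cdist_le.
Qed.

Lemma cdistC x y : cdist x y = cdist y x.
Proof. by rewrite /cdist; under eq_fun do rewrite fdistC. Qed.

Lemma cdist_triangle y x z : cdist x z <= cdist x y + cdist y z.
Proof.
apply/cdist_leP => n; apply: le_trans (fdist_triangle (y n) _ _) _.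
by apply: lerD; exact: cdist_le.
Qed.

(* Continuity on fuzzyc refers to this metric; similarly Phi on scbar. *)
HB.instance Definition _ :=
  isMetric.Build R fuzzyc cdistxx cdist_eq0 cdistC cdist_triangle.

Lemma fuzzyc_mdistE x y : mdist x y = cdist x y. Proof. by []. Qed.

Definition fuzzy_linear (A : fuzzyc -> R) :=
  (forall x y, A (cadd x y) = A x + A y) /\
  (forall l x, A (cmul l x) = l * A x).

End fuzzy_sequences.
Arguments fuzzyc R : clear implicits.

Section cbar.
Context {R : realType}.
Local Notation I := (unit_itv R).

Definition left_nbhs (x : I) := within [set y : I | \val y < \val x] (nbhs x).
Definition right_nbhs (x : I) := within [set y : I | \val x < \val y] (nbhs x).

Definition cbar_pred : {pred I -> R} := mem [set f : I -> R |
  [/\ bounded_fun f,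
      forall x, 0 < \val x -> f y @[y --> left_nbhs x] --> f x,
      forall x, \val x < 1 -> cvg (f y @[y --> right_nbhs x]) &
      forall x, \val x = 0 -> f y @[y --> right_nbhs x] --> f x]].

Record cbar := Cbar { cbar_fun :> I -> R ; cbarP : cbar_fun \in cbar_pred }.

HB.instance Definition _ := [isSub for cbar_fun].
HB.instance Definition _ := [Choice of cbar by <:].

Lemma cbar_submod_closed : submod_closed cbar_pred.
Proof.
split=> [|a f g].
  rewrite inE /=; split.
  - by exists 0; split => // M M0 x _; rewrite /= normr0 ltW.
  - by move=> x _; exact: cvg_cst.
  - by move=> x _; exact: is_cvg_cst.
  - by move=> x _; exact: cvg_cst.
rewrite !inE /= => -[[M [_ fM]] fl fr f0] [[N [_ gN]] gl gr g0]; split.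
- exists (`|a| * (M + 1) + (N + 1)); split=> [|K hK x _]; first exact: num_real.
  apply: le_trans (ltW hK); apply: le_trans (ler_normD _ _) _.
  apply: lerD; last by apply: gN; rewrite ?ltrDl.
  by rewrite normrM ler_wpM2l//; apply: fM; rewrite ?ltrDl.
- by move=> x x0; apply: cvgD; [apply: cvgMl_tmp; exact: fl|exact: gl].
- by move=> x x1; apply: is_cvgD; [apply: is_cvgMl_tmp; exact: fr|exact: gr].
- by move=> x x0; apply: cvgD; [apply: cvgMl_tmp; exact: f0|exact: g0].
Qed.

HB.instance Definition _ :=
  GRing.isSubmodClosed.Build R (I -> R) cbar_pred cbar_submod_closed.
HB.instance Definition _ := [SubChoice_isSubLmodule of cbar by <:].

Implicit Types f g : cbar.

Lemma cbarDE f g r : (f + g) r = f r + g r. Proof. by []. Qed.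
Lemma cbarNE f r : (- f) r = - f r. Proof. by []. Qed.
Lemma cbarZE a f r : (a *: f) r = a * f r. Proof. by []. Qed.

Definition unorm f : R := sup (range (fun r : I => `|f r|)).

Lemma unorm_has_sup f : has_sup (range (fun r : I => `|f r|)).
Proof.
have i0 : (0 : R) \in `[0, 1]%classic by rewrite inE /= in_itv /= lexx ler01.
split; first by exists `|f (exist _ 0 i0)|; eexists.
have := cbarP f; rewrite inE => -[[M [_ fM]] _ _ _].
by exists (M + 1) => _ [r _ <-]; apply: fM; rewrite ?ltrDl.
Qed.

Lemma unorm_leP f d : unorm f <= d <-> forall r, `|f r| <= d.
Proof.
have [S0 Sb] := unorm_has_sup f; split => [D n|h].
  by apply: le_trans D; apply: ub_le_sup => //; exists n.
by apply: ge_sup => // _ [n _ <-].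
Qed.

Lemma unorm_le f r : `|f r| <= unorm f.
Proof. exact: (iffLR (unorm_leP f _) (lexx _)). Qed.

Lemma unorm_ge0 f : 0 <= unorm f.
Proof.
have [[_ [r _ _]] _] := unorm_has_sup f.
exact: le_trans (normr_ge0 _) (unorm_le f r).
Qed.

Lemma unorm0 : unorm 0 = 0.
Proof.
by apply/eqP; rewrite eq_le unorm_ge0 andbT; apply/unorm_leP => r; rewrite normr0.
Qed.

Lemma unorm_eq0 f : unorm f = 0 -> f = 0.
Proof.
move=> f0; apply/val_inj/funext => r.
by apply/eqP; rewrite -normr_le0; apply: le_trans (unorm_le f r) _; rewrite f0.
Qed.

Lemma unormN f : unorm (- f) = unorm f.
Proof.
suff h g : unorm (- g) <= unorm g.
  by apply/eqP; rewrite eq_le h -{1}(opprK f) h.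
by apply/unorm_leP => r; rewrite cbarNE normrN; exact: unorm_le.
Qed.

Lemma unormD f g : unorm (f + g) <= unorm f + unorm g.
Proof.
apply/unorm_leP => r; apply: le_trans (ler_normD _ _) _.
by apply: lerD; exact: unorm_le.
Qed.

Definition ic : set cbar :=
  [set f | {homo (f : I -> R) : x y / \val x <= \val y >-> x <= y}].

End cbar.
Arguments cbar R : clear implicits.
Arguments ic R : clear implicits.

Section scbar.
Context {R : realType}.
Local Notation I := (unit_itv R).

Definition scbar_pred : {pred nat -> cbar R} := mem [set s : nat -> cbar R |
  exists f : I -> R, {uniform, (fun n => s n : I -> R) @ \oo --> f}].

Record scbar := Scbar {
  scbar_seq :> nat -> cbar R ; scbarP : scbar_seq \in scbar_pred }.

HB.instance Definition _ := [isSub for scbar_seq].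
HB.instance Definition _ := [Choice of scbar by <:].

Lemma cvg_uniformP (s : nat -> I -> R) (f : I -> R) :
  {uniform, s @ \oo --> f} <->
  forall e, 0 < e -> \forall n \near \oo, forall r, `|s n r - f r| <= e.
Proof.
split=> [sf e e0|h P /uniform_nbhs[E [/= entE EP]]].
  apply: (sf [set g | forall r, `|g r - f r| <= e]); apply/uniform_nbhs.
  exists [set xy : R * R | ball xy.1 e xy.2]; split.
    exact: (@entourage_ball R R (PosNum e0)).
  by move=> g /= hg r; have := hg r Logic.I; rewrite /ball /= distrC => /ltW.
have := entE; rewrite -entourage_ballE => -[e /= e0 eE].
have e20 : 0 < e / 2 by lra.
have := h _ e20; rewrite !nbhs_simpl; apply: filterS => n hn; apply: EP => r _.
by apply: eE; rewrite /= /ball /= distrC; have := hn r; lra.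
Qed.

Lemma scbar_submod_closed : submod_closed scbar_pred.
Proof.
split=> [|a s t].
  rewrite inE /=; exists (fun=> 0); apply/cvg_uniformP => e e0.
  by near=> n => r; rewrite subrr normr0 ltW.
rewrite !inE /= => -[f /cvg_uniformP sf] [g /cvg_uniformP tg].
exists (fun r => a * f r + g r); apply/cvg_uniformP => e e0.
have a0 : 0 < `|a| + 1 by rewrite ltr_wpDl.
have e1 : 0 < e / 2 / (`|a| + 1) by rewrite !divr_gt0.
have e2 : 0 < e / 2 by rewrite divr_gt0.
near=> n => r.
have -> : (a *: s + t) n r - (a * f r + g r) =
    a * (s n r - f r) + (t n r - g r).
  by rewrite (_ : (a *: s + t) n r = a * s n r + t n r)//; ring.
rewrite (splitr e); apply: le_trans (ler_normD _ _) _; apply: lerD.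
  rewrite normrM; apply: (@le_trans _ _ (`|a| * (e / 2 / (`|a| + 1)))).
    by rewrite ler_wpM2l//; move: r; near: n; exact: sf.
  by rewrite mulrA ler_pdivrMr// mulrC ler_wpM2l ?ltW// ltrDl.
by move: r; near: n; exact: tg.
Unshelve. all: by end_near. Qed.

HB.instance Definition _ :=
  GRing.isSubmodClosed.Build R (nat -> cbar R) scbar_pred scbar_submod_closed.
HB.instance Definition _ := [SubChoice_isSubLmodule of scbar by <:].

Implicit Types s t : scbar.

Lemma scbarDE s t n : (s + t) n = s n + t n. Proof. by []. Qed.
Lemma scbarNE s n : (- s) n = - s n. Proof. by []. Qed.
Lemma scbarZE a s n : (a *: s) n = a *: s n. Proof. by []. Qed.

Definition Phi s t : R := sup (range (fun n => unorm (s n - t n))).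

Lemma scbar_bounded s : exists M, forall n, unorm (s n) <= M.
Proof.
have := scbarP s; rewrite inE => -[f /cvg_uniformP sf].
have [N _ hN] := sf 1 ltr01.
exists (\sum_(i < N.+1) unorm (s i) + 2) => n.
have S0 (P : pred 'I_N.+1) : 0 <= \sum_(i < N.+1 | P i) unorm (s i).
  by apply: sumr_ge0 => i _; exact: unorm_ge0.
have [nN|Nn] := leqP n N.
  rewrite (bigD1 (Ordinal (nN : (n < N.+1)%N)))//= -addrA lerDl.
  by rewrite addr_ge0.
apply: (@le_trans _ _ (unorm (s N) + 2)).
  apply/unorm_leP => r; have := hN n (ltnW Nn) r; have := hN N (leqnn N) r.
  have := unorm_le (s N) r; rewrite !ler_norml => *; lra.
by rewrite lerD2r (bigD1 ord_max)//= lerDl.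
Qed.

Lemma Phi_has_sup s t : has_sup (range (fun n => unorm (s n - t n))).
Proof.
split; first by eexists; exists 0%N.
have [M hM] := scbar_bounded s; have [N hN] := scbar_bounded t.
exists (M + N) => _ [n _ <-]; apply: le_trans (unormD _ _) _.
by rewrite unormN lerD.
Qed.

Lemma Phi_leP s t d : Phi s t <= d <-> forall n, unorm (s n - t n) <= d.
Proof.
have [S0 Sb] := Phi_has_sup s t; split => [D n|h].
  by apply: le_trans D; apply: ub_le_sup => //; exists n.
by apply: ge_sup => // _ [n _ <-].
Qed.

Lemma Phi_le s t n : unorm (s n - t n) <= Phi s t.
Proof. exact: (iffLR (Phi_leP s t _) (lexx _)). Qed.

Lemma Phixx s : Phi s s = 0.
Proof.
apply/eqP; rewrite eq_le (le_trans (unorm_ge0 _) (Phi_le s s 0)) andbT.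
by apply/Phi_leP => n; rewrite subrr unorm0.
Qed.

Lemma Phi_eq0 s t : Phi s t = 0 -> s = t.
Proof.
move=> D0; apply/val_inj/funext => n; apply/eqP; rewrite -subr_eq0; apply/eqP.
by apply: unorm_eq0; apply/eqP; rewrite eq_le unorm_ge0 andbT (le_trans (Phi_le s t n))// D0.
Qed.

Lemma PhiC s t : Phi s t = Phi t s.
Proof.
suff h u v : Phi u v <= Phi v u by apply/eqP; rewrite eq_le !h.
by apply/Phi_leP => n; rewrite -unormN opprB; exact: Phi_le.
Qed.

Lemma Phi_triangle t s w : Phi s w <= Phi s t + Phi t w.
Proof.
apply/Phi_leP => n; rewrite -(subrK (t n) (s n)) -addrA.
by apply: le_trans (unormD _ _) _; apply: lerD; exact: Phi_le.
Qed.

HB.instance Definition _ :=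
  isMetric.Build R scbar Phixx Phi_eq0 PhiC Phi_triangle.

Lemma scbar_mdistE s t : mdist s t = Phi s t. Proof. by []. Qed.

Definition sic : set scbar := [set s | forall n, ic R (s n)].

End scbar.
Arguments scbar R : clear implicits.
Arguments sic R : clear implicits.

Section endpoints.
Context {R : realType}.
Local Notation I := (unit_itv R).

Lemma itv01P (r : I) : 0 <= \val r <= 1.
Proof. by have := valP r; rewrite inE /= in_itv. Qed.

Lemma nbhs_itv01 (x : I) (e : R) : 0 < e ->
  \forall y \near x, `|\val x - \val y| < e.
Proof.
by move=> e0; apply: filterS (nbhsx_ballx x _ e0) => y.
Qed.

Lemma monotone_cbar (f : I -> R) :
  {homo f : x y / \val x <= \val y >-> x <= y} ->
  (forall x e, 0 < \val x -> 0 < e ->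
    exists d, 0 < d /\ forall y : I, \val x - d < \val y -> \val y <= \val x ->
      f x - e < f y <= f x) ->
  (forall x e, \val x = 0 -> 0 < e ->
    exists d, 0 < d /\ forall y : I, \val y < d -> f x <= f y < f x + e) ->
  f \in cbar_pred.
Proof.
move=> fm fl f0.
have h0 : (0 : R) \in `[0, 1]%classic by rewrite inE /= in_itv /= lexx ler01.
have h1 : (1 : R) \in `[0, 1]%classic by rewrite inE /= in_itv /= lexx ler01.
pose i0 : I := exist _ 0 h0; pose i1 : I := exist _ 1 h1.
have fb y : f i0 <= f y <= f i1.
  by have /andP[y0 y1] := itv01P y; rewrite !fm.
rewrite inE; split.
- exists (`|f i0| + `|f i1|); split=> [|M hM y _]; first exact: num_real.
  apply: le_trans (ltW hM); rewrite ler_norml; have /andP[fy0 fy1] := fb y.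
  apply/andP; split.
    apply: le_trans fy0; rewrite lerNl (@le_trans _ _ `|f i0|) ?lerDl//.
    by rewrite -normrN ler_norm.
  apply: le_trans fy1 _; apply: le_trans (ler_norm _) _.
  by rewrite lerDr.
- move=> x x0; apply/cvgrPdist_le => e e0; have [d [d0 hd]] := fl x e x0 e0.
  have hx := nbhs_itv01 x d0; near=> y.
  have yx : \val y < \val x by near: y; exact: withinT.
  have : `|\val x - \val y| < d.
    by near: y; apply: cvg_within; exact: hx.
  rewrite ltr_distlC => /andP[hy _].
  have /andP[l1 l2] : f x - e < f y <= f x by apply: hd => //; exact: ltW.
  by rewrite ler_distlC (ltW l1) (le_trans l2)// lerDl ltW.
- move=> x x1; apply/cvg_ex.
  pose S := [set f y | y in [set y : I | \val x < \val y]].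
  have S0 : S !=set0 by exists (f i1), i1.
  have Sb : has_lbound S by exists (f i0) => _ [y _ <-]; case/andP: (fb y).
  exists (inf S); apply/cvgrPdist_le => e e0.
  have [_ [z /= xz <-] hz] := inf_adherent e0 (conj S0 Sb).
  have d0 : 0 < \val z - \val x by rewrite subr_gt0.
  have hx := nbhs_itv01 x d0; near=> y.
  have yx : \val x < \val y by near: y; exact: withinT.
  have : `|\val x - \val y| < \val z - \val x.
    by near: y; apply: cvg_within; exact: hx.
  rewrite ltr_distlC addrCA subrr addr0 => /andP[_ /ltW/fm yz].
  have h : inf S <= f y by apply: ge_inf => //; exists y.
  rewrite ler_distlC; apply/andP; split.
    by apply: le_trans h; rewrite lerBlDr lerDl ltW.
  exact: le_trans yz (ltW hz).
- move=> x x0; apply/cvgrPdist_le => e e0; have [d [d0 hd]] := f0 x e x0 e0.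
  have hx := nbhs_itv01 x d0; near=> y.
  have : `|\val x - \val y| < d.
    by near: y; apply: cvg_within; exact: hx.
  rewrite x0 sub0r normrN => /(le_lt_trans (ler_norm _)) hy.
  have /andP[l1 l2] := hd y hy.
  by rewrite ler_distlC (ltW l2) andbT (le_trans _ l1)// lerBlDr lerDl ltW.
Unshelve. all: by end_near. Qed.

Lemma cbar_lower_subproof (u : fuzzyNumber R) :
  (fun r : I => lower u (\val r)) \in cbar_pred.
Proof.
apply: monotone_cbar => [x y xy|x e x0 e0|x e x0 e0].
- have /andP[x0 x1] := itv01P x; have /andP[y0 y1] := itv01P y.
  exact: (lower_mono (fuzzyP u)).
- have /andP[_ x1] := itv01P x.
  have x01 : 0 < \val x <= 1 by rewrite x0.
  have [d [d0 hd]] := lower_left (fuzzyP u) x01 e0.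
  by exists d; split => // y; have /andP[y0 y1] := itv01P y; exact: hd.
- have [d [d0 hd]] := lower_right0 (fuzzyP u) e0.
  exists d; split => // y yd; have /andP[y0 y1] := itv01P y.
  by rewrite x0; exact: hd.
Qed.

Definition cbar_lower u := Cbar (cbar_lower_subproof u).

Lemma cbar_upper_subproof (u : fuzzyNumber R) :
  (fun r : I => upper u (\val r)) \in cbar_pred.
Proof.
have -> : (fun r : I => upper u (\val r)) = (- cbar_lower (fmul (-1) u) : cbar R).
  by apply/funext => r; rewrite (upperN (fuzzyP u) (itv01P r)).
exact: cbarP.
Qed.

Definition cbar_upper u := Cbar (cbar_upper_subproof u).

Lemma scbar_lower_subproof (x : fuzzyc R) :
  (fun n => cbar_lower (x n)) \in scbar_pred.
Proof.
rewrite inE; have [a xa] := fuzzyc_cvg x.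
exists (cbar_lower a); apply/cvg_uniformP => e e0.
move/cvgrPdist_le : xa => /(_ e e0); apply: filterS => n.
rewrite sub0r normrN ger0_norm ?fdist_ge0// => D r.
by have [h _] := fdist_le (x n) a (itv01P r); exact: le_trans D.
Qed.

Lemma scbar_upper_subproof (x : fuzzyc R) :
  (fun n => cbar_upper (x n)) \in scbar_pred.
Proof.
rewrite inE; have [a xa] := fuzzyc_cvg x.
exists (cbar_upper a); apply/cvg_uniformP => e e0.
move/cvgrPdist_le : xa => /(_ e e0); apply: filterS => n.
rewrite sub0r normrN ger0_norm ?fdist_ge0// => D r.
by have [_ h] := fdist_le (x n) a (itv01P r); exact: le_trans D.
Qed.

Definition scbar_lower x := Scbar (scbar_lower_subproof x).
Definition scbar_upper x := Scbar (scbar_upper_subproof x).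

End endpoints.

(* Main.v *)
Require Import Defs.
From HB Require Import structures.
From mathcomp Require Import all_boot all_order all_algebra.
From mathcomp Require Import all_classical all_reals all_analysis.
From mathcomp Require Import ring lra.

Import Order.TTheory GRing.Theory Num.Theory.
Import numFieldNormedType.Exports.

Local Open Scope classical_set_scope.
Local Open Scope ring_scope.

Set Implicit Arguments.
Unset Strict Implicit.
Unset Printing Implicit Defensive.

(* Since [x_- + x_+] is additive and homogeneous in [x] (also for negative
   scalars), a linear [A] factors through it: if [x_- + x_+ = y_- + y_+] then
   [z := x (+) (-1) y] satisfies [(-1) z = z], so [A z = 0].  The induced linear
   functional on the range extends to the whole space by Zorn's lemma.  Every
   increasing sequence [s] bounded by [2 c] is [x_- + x_+] for the fuzzy
   sequence with endpoints [s - c] and [c]; using the same [c] for all sequences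
   near [s] makes this lift isometric, so the extension is continuous on
   increasing sequences.  Conversely [L (x_- + x_+) = L x_- - L (- x_+)], where
   [x_-] and [- x_+] are increasing and 1-Lipschitz in [x]. *)

(** * Extension of linear functionals from a subspace *)

Section linear_extension.
Context {K : fieldType} {E : lmodType K}.
Implicit Types G H : set (E * K).

(** When nonempty, such a [G] is the graph of a linear map on a subspace. Sets of pairs are ordered
    by inclusion, so Zorn's lemma applies without carrying domains along. *)
Definition linear_graph G :=
  (forall a p q, G p -> G q -> G (a *: p.1 + q.1, a * p.2 + q.2)) /\
  (forall y, G (0, y) -> y = 0).

Lemma linear_graph_inj G x y z :
  linear_graph G -> G (x, y) -> G (x, z) -> y = z.
Proof.
move=> [Gl G0] Gy Gz; apply/esym/eqP; rewrite -subr_eq0; apply/eqP/G0.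
by have := Gl (-1) _ _ Gy Gz; rewrite /= scaleN1r mulN1r addNr addrC.
Qed.

(** The new vector [x] is sent to 0. A relation [a *: x + y = 0] with [a != 0] would give
    [x = - a^-1 *: y], which is already in the domain; so [a = 0] and the value is 0. *)
Lemma linear_graph_add_dom G x : linear_graph G -> G (0, 0) ->
  (forall y, ~ G (x, y)) ->
  linear_graph [set p | exists a y z, G (y, z) /\ p = (a *: x + y, z)].
Proof.
move=> [Gl G0] G00 xG; split.
  move=> b _ _ [a [y [z [Gy ->]]]] [a' [y' [z' [Gy' ->]]]] /=.
  exists (b * a + a'), (b *: y + y'), (b * z + z'); split.
    exact: (Gl _ (_, _) (_, _)).
  by rewrite scalerDr scalerDl scalerA addrACA.
move=> t [a [y [z [Gy [xy ->]]]]]; have [a0|a0] := eqVneq a 0.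
  by apply: G0; move: xy Gy; rewrite a0 scale0r add0r => <-.
case: (xG (- a^-1 * z)); have := Gl (- a^-1) _ _ Gy G00; rewrite /= !addr0.
suff -> : - a^-1 *: y = x by [].
have -> : y = - (a *: x) by apply/eqP; rewrite -addr_eq0 addrC -xy.
by rewrite scaleNr scalerN opprK scalerA mulVf// scale1r.
Qed.

(** A maximal graph is total, since a missing vector could still be added to its domain. *)
Lemma linear_graph_total G : linear_graph G -> G (0, 0) ->
  exists2 H, linear_graph H & G `<=` H /\ forall x, exists y, H (x, y).
Proof.
move=> lG G00.
(* The union with [G] makes the empty chain harmless. *)
have [|H [lH Hmax]] := @Zorn_bigcup _ [set X | linear_graph (X `|` G)].
  move=> F FP totF; pose U := (\bigcup_(X in F) X) `|` G.
  (* The two conditions on a graph involve at most two of its elements, so it suffices that any two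
     lie in one graph inside [U]. *)
  have up p q : U p -> U q ->
      exists X, [/\ linear_graph X, X p, X q & X `<=` U].
    have sub X : F X -> X `|` G `<=` U.
      by move=> FX r [Xr|Gr]; [left; exists X|right].
    move=> [[X FX Xp]|Gp] [[Y FY Yq]|Gq].
    - have [XY|YX] := totF _ _ FX FY.
        by exists (Y `|` G); split;
          [exact: FP|left; exact: XY|left|exact: sub].
      by exists (X `|` G); split; [exact: FP|left|left; exact: YX|exact: sub].
    - by exists (X `|` G); split; [exact: FP|left|right|exact: sub].
    - by exists (Y `|` G); split; [exact: FP|right|left|exact: sub].
    - by exists G; split => // r Gr; right.
  split=> [a p q Up Uq|y Uy].
    by have [X [[Xl _] Xp Xq]] := up _ _ Up Uq; apply; exact: Xl.
  by have [X [[_ X0] Xy _ _]] := up _ _ Uy Uy; exact: X0.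
exists (H `|` G) => //; split=> [p Gp|x]; first by right.
apply: contrapT => /forallNP xH.
have H00 : (H `|` G) (0, 0) by right.
pose C := [set p : E * K |
  exists a y z, (H `|` G) (y, z) /\ p = (a *: x + y, z)].
have HC : H `|` G `<=` C.
  by move=> [y z] Hy; exists 0, y, z; rewrite scale0r add0r.
apply: (Hmax C).
  split=> [p Hp|CH]; first by apply: HC; left.
  (* [C] contains [(x, 0)], hence is strictly larger than [H]. *)
  apply: (xH 0); left; apply: CH; exists 1, 0, 0.
  by rewrite scale1r addr0.
rewrite /= setUidl; first exact: linear_graph_add_dom.
by move=> p Gp; apply: HC; right.
Qed.

Lemma linear_graph_extension G : linear_graph G -> G (0, 0) ->
  exists L : {scalar E}, forall x y, G (x, y) -> L x = y.
Proof.
move=> lG G00; have [H lH [GH /choice[f Hf]]] := linear_graph_total lG G00.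
have fl : linear_for *%R f.
  move=> a x y; apply: (linear_graph_inj lH (Hf _)).
  exact: (proj1 lH a _ _ (Hf x) (Hf y)).
pose flM := GRing.isLinear.Build K E K *%R f fl.
pose L : {scalar E} := HB.pack f flM.
by exists L => x y Gxy; apply: (linear_graph_inj lH (Hf x)); exact: GH.
Qed.

End linear_extension.

(** * One-sided continuity in epsilon-delta form *)

Section unit_interval.
Context {R : realType}.
Local Notation I := (unit_itv R).
Implicit Types (f : cbar R) (x y r : I).

Lemma itv01_exists (t : R) : 0 <= t <= 1 -> exists r, \val r = t.
Proof.
move=> t01; have t_in : t \in `[0, 1]%classic by rewrite inE /= in_itv.
by exists (exist _ t t_in).
Qed.

Lemma cbar_left f x e : 0 < \val x -> 0 < e ->
  exists2 d, 0 < d & forall y, \val x - d < \val y -> \val y <= \val x ->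
    `|f y - f x| <= e.
Proof.
move=> x0 e0; have := cbarP f; rewrite inE => -[_ /(_ x x0) fx _ _].
move/cvgrPdist_le : fx => /(_ e e0) /nbhs_ballP[d d0 hd].
exists d => // y xy; rewrite le_eqVlt => /predU1P[/val_inj->|yx].
  by rewrite subrr normr0 ltW.
rewrite distrC; apply: hd => //.
by change (`|\val x - \val y| < d); rewrite ltr_distlC; lra.
Qed.

Lemma cbar_right0 f x e : \val x = 0 -> 0 < e ->
  exists2 d, 0 < d & forall y, \val y < d -> `|f y - f x| <= e.
Proof.
move=> x0 e0; have := cbarP f; rewrite inE => -[_ _ _ /(_ x x0) fx].
move/cvgrPdist_le : fx => /(_ e e0) /nbhs_ballP[d d0 hd].
exists d => // y yd; have [y0|y0] := leP (\val y) 0.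
  have -> : y = x.
    by apply: val_inj; apply/eqP; rewrite eq_le x0 y0; case/andP: (itv01P y).
  by rewrite subrr normr0 ltW.
rewrite distrC; apply: hd; rewrite ?x0//.
by change (`|\val x - \val y| < d); rewrite ltr_distlC x0; lra.
Qed.

(** Points of [A] above [r] bound [f r] by monotonicity; points just below [r] do so up to [e] by
    left continuity. *)
Lemma ic_le_left f (A : set I) r c : ic R f -> 0 < \val r ->
  (forall d, 0 < d -> exists2 s, A s & \val r - d < \val s) ->
  (forall s, A s -> f s <= c) -> f r <= c.
Proof.
move=> fm r0 Ar fc; apply/ler_addgt0Pr => e e0.
have [d d0 hd] := cbar_left f r0 e0; have [s As rs] := Ar d d0.
have [rs'|/ltW sr] := leP (\val r) (\val s).
  by have := fm r s rs'; have := fc s As; lra.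
by have := hd s rs sr; have := fc s As; rewrite ler_norml; lra.
Qed.

End unit_interval.

(** * A fuzzy number with prescribed endpoint functions *)

Section membership_of_endpoints.
Context {R : realType}.
Local Notation I := (unit_itv R).
Variables g h : cbar R.
Hypotheses (gm : ic R g) (hm : ic R (- h)) (gh : forall r, g r <= h r).
Implicit Types (r s : I) (x y : R).

(* The disjunct [\val r = 0] keeps the supremum over a nonempty set. *)
Definition endpoint_membership x : R :=
  sup [set \val r | r in [set r : I | \val r = 0 \/ g r <= x <= h r]].

Local Notation u := endpoint_membership.

Lemma endpoint_membership_has_sup x :
  has_sup [set \val r | r in [set r : I | \val r = 0 \/ g r <= x <= h r]].
Proof.
have [|r0 r00] := @itv01_exists R 0; first by rewrite lexx ler01.
split; first by exists (\val r0), r0 => //; left.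
by exists 1 => _ [r _ <-]; case/andP: (itv01P r).
Qed.

Lemma endpoint_membership01 x : 0 <= u x <= 1.
Proof.
have [S0 Sb] := endpoint_membership_has_sup x.
have [|r0 r00] := @itv01_exists R 0; first by rewrite lexx ler01.
apply/andP; split; first by apply: ub_le_sup => //; exists r0 => //; left.
by apply: ge_sup => // _ [r _ <-]; case/andP: (itv01P r).
Qed.

(** The supremum need not be attained a priori: levels approaching it give the inequalities near
    [r], and left continuity of [g] and [h] carries them to [r] itself. *)
Lemma endpoint_membershipP r x : 0 < \val r ->
  (\val r <= u x) = (g r <= x <= h r).
Proof.
move=> r0; have hs := endpoint_membership_has_sup x.
apply/idP/idP => [ru|xr]; last first.
  by apply: ub_le_sup; [exact: hs.2|exists r => //; right].
pose A : set I := [set s | g s <= x <= h s].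
have Ar d : 0 < d -> exists2 s, A s & \val r - d < \val s.
  (* Capping the distance by [\val r] keeps [s] positive, which rules out the disjunct
     [\val s = 0]. *)
  move=> d0; have m0 : 0 < Num.min d (\val r) by rewrite lt_min d0.
  have [_ [s As <-] us] := sup_adherent m0 hs.
  have sm : \val r - Num.min d (\val r) < \val s.
    by apply: le_lt_trans us; rewrite lerB.
  have s1 : \val r - d < \val s.
    by apply: le_lt_trans sm; rewrite lerB// ge_min lexx.
  have s0 : 0 < \val s.
    by apply: le_lt_trans sm; rewrite subr_ge0 ge_min lexx orbT.
  by exists s => //; case: As => // s00; move: s0; rewrite s00 ltxx.
apply/andP; split; first by apply: ic_le_left gm r0 Ar _ => s /andP[].
rewrite -lerN2; apply: (ic_le_left (f := - h) hm r0 Ar) => s /andP[_].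
by rewrite cbarNE lerN2.
Qed.

(** At positive levels the superlevel sets are the intervals [[g r, h r]]: their convexity gives
    quasiconcavity, their closedness upper semicontinuity, and a point of the interval at level 1
    the maximum. *)
Lemma fuzzy_endpoint_membership : fuzzy u.
Proof.
have u01 := endpoint_membership01.
have [|r1 r11] := @itv01_exists R 1; first by rewrite lexx ler01.
split => //.
- exists (g r1); have : \val r1 <= u (g r1).
    by rewrite endpoint_membershipP ?r11// lexx gh.
  by have := u01 (g r1); rewrite r11; lra.
- move=> t x y t01; set m := Num.min _ _.
  have [m0|m0] := leP m 0; first by have := u01 (t * x + (1 - t) * y); lra.
  have [|r rm] := @itv01_exists R m.
    by rewrite ltW//= /m ge_min; case/andP: (u01 x) => _ ->.
  have : m <= m by []; rewrite {2}/m le_min -rm !endpoint_membershipP ?rm//.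
  have t0 : 0 <= t by lra.
  have t1 : 0 <= 1 - t by lra.
  move=> /andP[/andP[x1 x2] /andP[y1 y2]].
  have := ler_wpM2l t0 x1; have := ler_wpM2l t0 x2.
  by have := ler_wpM2l t1 y1; have := ler_wpM2l t1 y2; lra.
- move=> x a xa; have [a1|a1] := ltP 1 a.
    by apply: nbhs_all => y; have := u01 y; lra.
  have a0 : 0 < a by have := u01 x; lra.
  have [|r ra] := @itv01_exists R a; first by rewrite ltW.
  have r0 : 0 < \val r by rewrite ra.
  have /negbT := lt_geF xa; rewrite -ra endpoint_membershipP// negb_and -!ltNge.
  move=> /orP[] hx.
    have d0 : 0 < g r - x by lra.
    apply: filterS (nbhsx_ballx x _ d0) => y; rewrite /ball /= ltr_distlC => hy.
    by rewrite ltNge endpoint_membershipP//; lra.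
  have d0 : 0 < x - h r by lra.
  apply: filterS (nbhsx_ballx x _ d0) => y; rewrite /ball /= ltr_distlC => hy.
  by rewrite ltNge endpoint_membershipP//; lra.
- apply: (@bounded_compact_closure _ _ (unorm g + unorm h)) => x /= ux.
  have [|r rx] := @itv01_exists R (u x); first exact: u01.
  have : \val r <= u x by rewrite rx.
  rewrite endpoint_membershipP ?rx//.
  have := unorm_le g r; have := unorm_le h r; rewrite !ler_norml; lra.
Qed.

Lemma endpoint_membership_endpoints_gt0 r : 0 < \val r ->
  lower u (\val r) = g r /\ upper u (\val r) = h r.
Proof.
move=> r0; have : level u (\val r) = `[g r, h r]%classic.
  rewrite /level (gt_eqF r0).
  by apply/seteqP; split => x /=; rewrite in_itv /= endpoint_membershipP.
by rewrite /lower /upper => ->; rewrite inf_itvcc ?sup_itvcc.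
Qed.

(** Level 0 is the closure of the support, not a superlevel set, so its endpoints are found as
    limits from positive levels, by right continuity at 0 on both sides. *)
Lemma endpoint_membership_endpoints r :
  lower u (\val r) = g r /\ upper u (\val r) = h r.
Proof.
have [r00|rn0] := eqVneq (\val r) 0; last first.
  apply: endpoint_membership_endpoints_gt0.
  by rewrite lt_neqAle eq_sym rn0; case/andP: (itv01P r).
have fu := fuzzy_endpoint_membership.
have near0 e : 0 < e ->
    `|lower u 0 - g r| <= e /\ `|upper u 0 - h r| <= e.
  move=> e0; have e20 : 0 < e / 2 by lra.
  have [d1 [d10 h1]] := Defs.lower_right0 fu e20.
  have [d2 [d20 h2]] := Defs.upper_right0 fu e20.
  have [d3 d30 h3] := cbar_right0 g r00 e20.
  have [d4 d40 h4] := cbar_right0 h r00 e20.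
  pose m := Num.min (Num.min d1 d2) (Num.min (Num.min d3 d4) 1).
  have m0 : 0 < m by rewrite !lt_min d10 d20 d30 d40 ltr01.
  have : m <= m by [].
  rewrite {2}/m !le_min => /andP[/andP[? ?] /andP[/andP[? ?] ?]].
  (* [m / 2] is a positive level inside all four radii and below 1. *)
  have [|s sm] := @itv01_exists R (m / 2); first by lra.
  have s0 : 0 < \val s by lra.
  have [ls us] := endpoint_membership_endpoints_gt0 s0.
  have := h1 (\val s); have := h2 (\val s); have := h3 s; have := h4 s.
  rewrite ls us !ler_norml.
  move=> /(_ ltac:(lra)) ? /(_ ltac:(lra)) ?.
  move=> /(_ ltac:(lra) ltac:(lra) ltac:(lra)) ?.
  move=> /(_ ltac:(lra) ltac:(lra) ltac:(lra)) ?.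
  by split; lra.
rewrite r00; split; apply/eqP; rewrite -subr_eq0 -normr_le0;
  by apply/ler_addgt0Pr => e /near0; rewrite add0r => -[].
Qed.

End membership_of_endpoints.

(* The Goetschel-Voxman representation theorem. *)
Lemma fuzzyNumber_of_endpoints (R : realType) (g h : cbar R) :
  ic R g -> ic R (- h) -> (forall r, g r <= h r) ->
  exists2 u : fuzzyNumber R, cbar_lower u = g & cbar_upper u = h.
Proof.
move=> gm hm gh; have fu := fuzzy_endpoint_membership gm hm gh.
by exists (FuzzyNumber fu); apply/val_inj/funext => r /=;
  have [] := endpoint_membership_endpoints gm hm gh r.
Qed.

(** * Sequences of fuzzy numbers through their endpoint sequences *)

Section endpoint_sequences.
Context {R : realType}.
Local Notation I := (unit_itv R).
Implicit Types (u v : fuzzyNumber R) (x y : fuzzyc R) (s t : scbar R).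

Lemma cbar_lower_fadd u v : cbar_lower (fadd u v) = cbar_lower u + cbar_lower v.
Proof.
apply/val_inj/funext => r.
by rewrite /= lower_foplus//; [exact: fuzzyP..|exact: itv01P].
Qed.

Lemma cbar_upper_fadd u v : cbar_upper (fadd u v) = cbar_upper u + cbar_upper v.
Proof.
apply/val_inj/funext => r.
by rewrite /= upper_foplus//; [exact: fuzzyP..|exact: itv01P].
Qed.

(** A negative scalar exchanges the two endpoints, which their sum does not see. *)
Lemma cbar_fmul_lower_upper (l : R) u :
  cbar_lower (fmul l u) + cbar_upper (fmul l u) =
  l *: (cbar_lower u + cbar_upper u).
Proof.
apply/val_inj/funext => r /=; rewrite !fctE.
have [-> ->] := fscale_endpoints l (fuzzyP u) (itv01P r).
by rewrite -[RHS]/(l * (_ + _)) mulrDr; case: ifP => _; rewrite // addrC.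
Qed.

Lemma cbar_lower_ic u : ic R (cbar_lower u).
Proof.
move=> r s rs; have /andP[r0 _] := itv01P r; have /andP[_ s1] := itv01P s.
exact: (lower_mono (fuzzyP u)).
Qed.

Lemma cbar_upper_ic u : ic R (- cbar_upper u).
Proof.
move=> r s rs; have /andP[r0 _] := itv01P r; have /andP[_ s1] := itv01P s.
by rewrite !cbarNE lerN2; exact: (upper_mono (fuzzyP u)).
Qed.

Lemma fdist_unormP u v d : fdist u v <= d <->
  unorm (cbar_lower u - cbar_lower v) <= d /\
  unorm (cbar_upper u - cbar_upper v) <= d.
Proof.
rewrite fdist_leP !unorm_leP; split=> [h|[h1 h2] r r01].
  by split=> r; have [] := h _ (itv01P r).
by have [q <-] := itv01_exists r01; split; [exact: h1|exact: h2].
Qed.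

Lemma cdist_PhiP x y d : cdist x y <= d <->
  Phi (scbar_lower x) (scbar_lower y) <= d /\
  Phi (scbar_upper x) (scbar_upper y) <= d.
Proof.
rewrite cdist_leP !Phi_leP; split=> [h|[h1 h2] n].
  by split=> n; have /fdist_unormP[] := h n.
by apply/fdist_unormP; split; [exact: h1|exact: h2].
Qed.

Lemma fuzzyc_eqP x y : scbar_lower x = scbar_lower y ->
  scbar_upper x = scbar_upper y -> x = y.
Proof.
move=> lxy uxy; apply: cdist_eq0; apply/eqP.
rewrite eq_le (le_trans (fdist_ge0 _ _) (cdist_le x y 0)) andbT.
by apply/cdist_PhiP; rewrite lxy uxy !Phixx.
Qed.

(** [scbar] provides a mere limit function; monotonicity and one-sided continuity pass to it by
    uniform convergence. *)
Lemma sic_limit s : sic R s -> exists2 f : cbar R, ic R f &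
  forall e, 0 < e -> \forall n \near \oo, unorm (s n - f) <= e.
Proof.
move=> sm; have := scbarP s; rewrite inE => -[f /cvg_uniformP sf].
have close e : 0 < e -> exists n, forall r, `|s n r - f r| <= e.
  by move=> /sf[n _ hn]; exists n; apply: hn => /=.
have fm : {homo f : x y / \val x <= \val y >-> x <= y}.
  move=> x y xy; apply/ler_addgt0Pr => e e0.
  have [|n hn] := close (e / 2); first by lra.
  have := hn x; have := hn y; have := sm n x y xy.
  by rewrite !ler_norml; lra.
have fP : f \in cbar_pred.
  apply: monotone_cbar => // x e x0 e0.
    (* Three errors of [e / 4] leave room for the strict inequality. *)
    have e40 : 0 < e / 4 by lra.
    have [n hn] := close _ e40; have [d d0 hd] := cbar_left (s n) x0 e40.
    exists d; split => // y dy yx; rewrite fm// andbT.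
    have := hn x; have := hn y; have := hd y dy yx; rewrite !ler_norml; lra.
  have e40 : 0 < e / 4 by lra.
  have [n hn] := close _ e40; have [d d0 hd] := cbar_right0 (s n) x0 e40.
  exists d; split => // y dy; rewrite fm/=; last first.
    by rewrite x0; case/andP: (itv01P y).
  have := hn x; have := hn y; have := hd y dy; rewrite !ler_norml; lra.
exists (Cbar fP) => // e e0; apply: filterS (sf e e0) => n hn.
by apply/unorm_leP => r; exact: hn.
Qed.

(** The terms come from the representation theorem, and so does their limit: the limits of [s] and
    [t] are again admissible endpoint functions. *)
Lemma fuzzyc_of_endpoints s t : sic R s -> sic R (- t) ->
  (forall n r, s n r <= t n r) ->
  exists2 x, scbar_lower x = s & scbar_upper x = t.
Proof.
move=> sm tm st.
have /choice[z zE] n : exists u, cbar_lower u = s n /\ cbar_upper u = t n.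
  have [u <- <-] := fuzzyNumber_of_endpoints (sm n) (tm n) (st n); by exists u.
(* [g] is the limit of [- t], so [- g] will be the upper endpoint of the limit. *)
have [f fm sf] := sic_limit sm; have [g gm tg] := sic_limit tm.
have gm' : ic R (- - g) by rewrite opprK.
have tg' e : 0 < e -> \forall n \near \oo, unorm (t n - - g) <= e.
  move=> /tg; apply: filterS => n.
  by rewrite scbarNE -opprD unormN opprK.
have fg r : f r <= (- g) r.
  apply/ler_addgt0Pr => e e0; have e20 : 0 < e / 2 by lra.
  near \oo => n.
  have : unorm (s n - f) <= e / 2 by near: n; exact: sf.
  have : unorm (t n - - g) <= e / 2 by near: n; exact: tg'.
  move=> /unorm_leP/(_ r) + /unorm_leP/(_ r); have := st n r.
  rewrite !cbarDE !cbarNE !ler_norml; lra.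
have [a la ua] := fuzzyNumber_of_endpoints fm gm' fg.
have za : exists a, fuzzy_cvg z a.
  exists a; apply/cvgrPdist_le => e e0; near=> n.
  rewrite sub0r normrN ger0_norm ?fdist_ge0//; apply/fdist_unormP.
  have [-> ->] := zE n; rewrite la ua.
  by split; near: n; [exact: sf|exact: tg'].
exists (Fuzzyc za); apply/val_inj/funext => n /=; by have [] := zE n.
Unshelve. all: by end_near. Qed.

Lemma cst_cbar_subproof (c : R) : (fun _ : I => c) \in cbar_pred.
Proof. by apply: monotone_cbar => // x e _ e0; exists 1; split => // y; lra. Qed.

Definition cst_cbar c := Cbar (cst_cbar_subproof c).

Lemma cst_scbar_subproof (c : R) : (fun _ : nat => cst_cbar c) \in scbar_pred.
Proof.
rewrite inE; exists (fun=> c); apply/cvg_uniformP => e e0.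
by near=> n => r; rewrite subrr normr0 ltW.
Unshelve. all: by end_near. Qed.

Definition cst_scbar c := Scbar (cst_scbar_subproof c).

(** The two endpoints add up to [s], and the bound on [s] yields [s - c <= c]. *)
Lemma fuzzyc_with_cst_upper s (c : R) :
  sic R s -> (forall n, unorm (s n) <= c + c) ->
  exists2 x, scbar_lower x = s - cst_scbar c & scbar_upper x = cst_scbar c.
Proof.
move=> sm sc; apply: fuzzyc_of_endpoints => [n r q rq|n r q rq|n r].
- by rewrite !scbarDE !scbarNE !cbarDE !cbarNE lerD2r; exact: sm.
- by rewrite scbarNE !cbarNE.
- have /unorm_leP/(_ r) := sc n.
  by rewrite scbarDE scbarNE cbarDE cbarNE /= ler_norml; lra.
Qed.

End endpoint_sequences.

(** * Functionals of the sum of the endpoints *)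

Section endpoint_sums.
Context {R : realType}.
Implicit Types (u : fuzzyNumber R) (x y : fuzzyc R) (A : fuzzyc R -> R).

Definition endpoint_sum x : scbar R := scbar_lower x + scbar_upper x.

Lemma endpoint_sum_cadd x y :
  endpoint_sum (Defs.cadd x y) = endpoint_sum x + endpoint_sum y.
Proof.
rewrite /endpoint_sum.
have -> : scbar_lower (Defs.cadd x y) = scbar_lower x + scbar_lower y.
  by apply/val_inj/funext => n; exact: cbar_lower_fadd.
have -> : scbar_upper (Defs.cadd x y) = scbar_upper x + scbar_upper y.
  by apply/val_inj/funext => n; exact: cbar_upper_fadd.
exact: addrACA.
Qed.

Lemma endpoint_sum_cmul (l : R) x :
  endpoint_sum (cmul l x) = l *: endpoint_sum x.
Proof. by apply/val_inj/funext => n; exact: cbar_fmul_lower_upper. Qed.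

Lemma cbar_lower_fmulN1 u : cbar_lower (fmul (-1) u) = - cbar_upper u.
Proof.
apply/val_inj/funext => r /=.
have [-> _] := fscale_endpoints (-1) (fuzzyP u) (itv01P r).
by rewrite oppr_ge0 (lt_geF ltr01) mulN1r.
Qed.

Lemma cbar_upper_fmulN1 u : cbar_upper (fmul (-1) u) = - cbar_lower u.
Proof.
apply/val_inj/funext => r /=.
have [_ ->] := fscale_endpoints (-1) (fuzzyP u) (itv01P r).
by rewrite oppr_ge0 (lt_geF ltr01) mulN1r.
Qed.

(* Such an [x] is symmetric: [cmul (-1) x = x], so [A x = - A x]. *)
Lemma fuzzy_linear_eq0 A x : fuzzy_linear A -> endpoint_sum x = 0 -> A x = 0.
Proof.
move=> [_ AZ] /eqP; rewrite /endpoint_sum addr_eq0 => /eqP lx.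
have xN : cmul (-1) x = x.
  apply: fuzzyc_eqP; apply/val_inj/funext => n.
    by rewrite -[LHS]/(cbar_lower _) cbar_lower_fmulN1 lx.
  rewrite -[LHS]/(cbar_upper _) cbar_upper_fmulN1.
  by rewrite -[cbar_lower _]/(scbar_lower x n) lx opprK.
by have := AZ (-1) x; rewrite xN mulN1r; lra.
Qed.

Lemma fuzzy_linear_factor A : fuzzy_linear A ->
  exists L : {scalar (scbar R)}, forall x, A x = L (endpoint_sum x).
Proof.
move=> Al; have [AD AZ] := Al.
pose G : set (scbar R * R) := [set (endpoint_sum x, A x) | x in setT].
have lG : linear_graph G.
  (* Single-valuedness is asked only over 0, so no difference of fuzzy sequences has to be formed
     here. *)
  split=> [a _ _ [x _ <-] [y _ <-]|y [x _ xy]]; last first.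
    have <- : A x = y := congr1 snd xy.
    exact: fuzzy_linear_eq0 Al (congr1 fst xy).
  exists (Defs.cadd (cmul a x) y) => //=.
  by rewrite endpoint_sum_cadd endpoint_sum_cmul AD AZ.
have G00 : G (0, 0).
  have [u _ _] := @fuzzyNumber_of_endpoints R 0 0 (fun _ _ _ => lexx _)
    (fun _ _ _ => lexx _) (fun=> lexx _).
  have uc : exists a, fuzzy_cvg (fun=> u) a.
    by exists u; rewrite /fuzzy_cvg fdistxx; exact: cvg_cst.
  (* Scaling by 0 makes both the endpoint sum and the value of [A] vanish by homogeneity. *)
  pose z := cmul 0 (Fuzzyc uc); exists z => //.
  by rewrite endpoint_sum_cmul AZ scale0r mul0r.
have [L hL] := linear_graph_extension lG G00.
by exists L => x; apply/esym/hL; exists x.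
Qed.

Lemma sic_continuous_of_endpoint_sum A (L : {scalar (scbar R)}) :
  (forall x, A x = L (endpoint_sum x)) -> continuous A ->
  {within sic R, continuous L}.
Proof.
move=> AL Ac; apply/subspace_continuousP => s sm.
have [M sM] := scbar_bounded s.
have M0 : 0 <= M by apply: le_trans (sM 0); exact: unorm_ge0.
(* The margin 1 lets the same upper endpoint serve every [t] near [s]. *)
pose c := M + 1.
have lift t : sic R t -> Phi s t < 1 ->
    exists2 x, scbar_lower x = t - cst_scbar c & scbar_upper x = cst_scbar c.
  move=> tm st; apply: fuzzyc_with_cst_upper => // n.
  (* This gives [unorm (t n) <= M + 1 = c <= c + c]. *)
  have := unormD (s n) (t n - s n); have := Phi_le s t n; have := sM n.
  have -> : s n + (t n - s n) = t n by rewrite addrC subrK.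
  by rewrite -(unormN (t n - s n)) opprB /c; lra.
have LE t x : scbar_lower x = t - cst_scbar c -> scbar_upper x = cst_scbar c ->
    L t = A x.
  by move=> lx ux; rewrite AL /endpoint_sum lx ux subrK.
have close d : 0 < d -> \forall t \near s, Phi s t < d.
  by move=> d0; apply: filterS (nbhsx_ballx s _ d0) => t; rewrite ballEmdist.
have [|x lx ux] := lift s sm; first by rewrite Phixx.
apply/cvgrPdist_lt => e e0; have /cvgrPdist_lt/(_ e e0) := Ac x.
move=> /nbhs_ballP[d d0 hd]; near=> t.
have tm : sic R t by near: t; exact: withinT.
have [st1 st] : Phi s t < 1 /\ Phi s t < d.
  by split; near: t; apply: cvg_within; exact: close.
have [y ly uy] := lift t tm st1.
change (`|L s - L t| < e); rewrite (LE s x lx ux) (LE t y ly uy); apply: hd.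
(* Both lifts have the same upper endpoint and the shift by [c] cancels in the lower one, so their
   distance is at most [Phi s t]. *)
rewrite ballEmdist /= fuzzyc_mdistE; apply: le_lt_trans st.
apply/cdist_PhiP; rewrite lx ux ly uy; split; apply/Phi_leP => n.
  by have := Phi_le s t n; rewrite !scbarDE opprD addrACA subrr addr0.
by rewrite subrr unorm0 (le_trans (unorm_ge0 _) (Phi_le s t n)).
Unshelve. all: by end_near. Qed.

Lemma sic_continuous_comp (L : scbar R -> R) (f : fuzzyc R -> scbar R) :
  {within sic R, continuous L} -> (forall x, sic R (f x)) ->
  (forall x y, Phi (f x) (f y) <= cdist x y) -> continuous (L \o f).
Proof.
move=> /subspace_continuousP Lc fm fle x.
apply: cvg_comp (Lc _ (fm x)) => P /nbhs_ballP[d d0 hd].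
apply: filterS (nbhsx_ballx x _ d0) => y; rewrite ballEmdist => xy.
by apply: (hd (f y)) => //; rewrite ballEmdist; exact: le_lt_trans (fle x y) xy.
Qed.

(** [endpoint_sum x] need not be increasing, so continuity on [sic R] is applied to the increasing
    sequences [scbar_lower x] and [- scbar_upper x] separately. *)
Lemma continuous_of_sic_continuous (L : {scalar (scbar R)}) :
  {within sic R, continuous L} -> continuous (L \o endpoint_sum).
Proof.
move=> Lc.
have lc := sic_continuous_comp Lc (f := scbar_lower)
  (fun x n => cbar_lower_ic (x n))
  (fun x y => proj1 (iffLR (cdist_PhiP x y _) (lexx _))).
have uc : continuous (L \o (fun x => - scbar_upper x)).
  apply: sic_continuous_comp Lc _ _ => [x n|x y]; first exact: cbar_upper_ic.
  have /cdist_PhiP[_] := lexx (cdist x y); apply: le_trans; apply/Phi_leP => n.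
  by rewrite !scbarNE -opprD unormN; exact: Phi_le.
have -> : L \o endpoint_sum =
    (L \o scbar_lower) \- (L \o (fun x => - scbar_upper x)).
  by apply/funext => x /=; rewrite raddfD raddfN opprK.
move=> x; exact: (cvgB (lc x) (uc x)).
Qed.

End endpoint_sums.

Theorem theorem3p2 (R : realType) (xstar : fuzzyc R -> R) :
  fuzzy_linear xstar /\ continuous xstar <->
  exists L : {scalar (scbar R)},
    (forall x : fuzzyc R, xstar x = L (scbar_lower x + scbar_upper x)) /\
    {within sic R, continuous L}.
Proof.
split=> [[Al Ac]|[L [AL Lc]]].
  have [L AL] := fuzzy_linear_factor Al; exists L; split => //.
  exact: sic_continuous_of_endpoint_sum AL Ac.
have -> : xstar = L \o endpoint_sum by apply/funext => x; exact: AL.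
split; last exact: continuous_of_sic_continuous.
split=> [x y|l x] /=; first by rewrite endpoint_sum_cadd raddfD.
by rewrite endpoint_sum_cmul linearZ.
Qed.
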